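(* Let $V$ be a finite set and $E$ a finite index set, $p\ge1$, $\{w_e\}_{e\in E}$ positive numbers, and $\{f_e:\mathcal P(V)\to[0,\infty)\}_{e\in E}$, $\{g_e:\mathcal P(V)\to[0,\infty)\}_{e\in E}$ families with $f_e(\varnothing)=f_e(V)=0=g_e(\varnothing)$ and $g_e(A)=\sum_{i\in A}g_e(\{i\})$ for all $A\subset V$. Put $f(A)=\sum_{e\in E}w_ef_e(A)$, $g(A)=\sum_{e\in E}g_e(A)$, and assume $g(i):=g(\{i\})>0$ for all $i\in V$. Let $$h=\min_{A\subset V,\ A\notin\{\varnothing,V\}}\frac{f(A)}{\min\{g(A),g(V\setminus A)\}},\qquad \lambda=\inf_{x\text{ nonconstant}}\frac{\sum_{e\in E}w_e\,(f_e^L(x))^p}{\min_{t\in\mathbb R}\sum_{e\in E}g_e^L(|x-t\mathbf 1|^p)}.$$ Then $$\Big(\frac2c\Big)^{p-1}\frac{h^p}{p^p}\ \le\ \lambda\ \le\ 2^{p-1}C\,h,$$ where $C=\max_{e,A}f_e(A)^{p-1}$ and $$c=\max_{i\in V}\frac{\sum_{e\in E_i}w_e}{g(i)},\qquad E_i=\{e\in E:\ \exists S\subset V\text{ with }f_e(S\setminus\{i\})\ne f_e(S)\}.$$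
   Context: For $u:\mathcal P(V)\to\mathbb R$ with $n=\#V$, the original Lovász extension is $u^L(x)=\sum_{i=1}^{n-1}(x_{(i+1)}-x_{(i)})\,u(V_i(x))+x_{(1)}u(V)$, where $x_{(1)}\le\dots\le x_{(n)}$ is the non-decreasing rearrangement of $x\in\mathbb R^n$ and $V_i(x)=\{j\in V:x_j>x_{(i)}\}$. $|x|^p$ is taken componentwise, $\mathbf 1$ is the all-ones vector. The number $\lambda$ is the (variational expression of the) second eigenvalue of the eigenvalue problem $0\in\nabla\sum_ew_e(f_e^L(x))^p-\lambda\nabla\sum_eg_e^L(|x|^p)$. *)

(* Defs.v *)
From HB Require Import structures.
From mathcomp Require Import all_boot all_order all_algebra.
From mathcomp Require Import all_classical all_reals all_analysis.

Set Implicit Arguments.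
Unset Strict Implicit.
Unset Printing Implicit Defensive.

Import Order.TTheory GRing.Theory Num.Theory.
Local Open Scope ring_scope.

(* With s the non-decreasing rearrangement of x, s`_i is the x_(i+1) of the
   usual 1-based notation, so that i ranges over 0, ..., n - 2. *)
Definition lovasz (R : realType) (V : finType)
    (u : {set V} -> R) (x : V -> R) : R :=
  let s := sort <=%R (codom x) in
  \sum_(0 <= i < #|V|.-1)
     (s`_i.+1 - s`_i) * u ([set j : V | s`_i < x j]%SET)
  + s`_0 * u ([set: V]%SET).

Definition nonconstant (R : realType) (V : finType) (x : V -> R) : Prop :=
  exists i j : V, x i != x j.

Section Quantities.

Variables (R : realType) (V E : finType).
Variables (w : E -> R) (f g : E -> {set V} -> R).

Definition total_f (A : {set V}) : R := \sum_(e : E) w e * f e A.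

Definition total_g (A : {set V}) : R := \sum_(e : E) g e A.

(* When #|V| >= 2 this is the infimum of a nonempty finite set, hence its
   minimum. *)
Definition cheeger : R :=
  inf [set total_f A / Num.min (total_g A) (total_g (~: A)%SET)
      | A in [set A : {set V} | A != finset.set0 /\ A != [set: V]%SET]%classic
      ]%classic.

(* For additive g e >= 0, the function of t below is a nonnegative linear
   combination of the |x_i - t|^p: continuous, and coercive if its weights are
   not all 0.  The infimum is thus a minimum. *)
Definition min_deviation (p : R) (x : V -> R) : R :=
  inf [set \sum_(e : E) lovasz (g e) (fun i => `|x i - t| `^ p)
      | t in [set: R]]%classic.

Definition lambda2 (p : R) : R :=
  inf [set (\sum_(e : E) w e * lovasz (f e) x `^ p) / min_deviation p x
      | x in [set x : V -> R | nonconstant x]]%classic.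

(* The maxima defining const_C and const_c are over nonnegative reals, so 0 is
   a neutral default.  For p = 1 the convention 0 `^ 0 = 1 gives const_C = 1. *)
Definition const_C (p : R) : R :=
  \big[Num.max/0]_(e : E) \big[Num.max/0]_(A : {set V}) f e A `^ (p - 1).

Definition incident (i : V) : {set E} :=
  [set e : E | [exists S : {set V}, f e (S :\ i)%SET != f e S]]%SET.

Definition const_c : R :=
  \big[Num.max/0]_(i : V)
    ((\sum_(e in incident i) w e) / total_g ([set i]%SET)).

End Quantities.

(* Main.v *)
Require Import Defs.
From HB Require Import structures.
From mathcomp Require Import all_boot all_order all_algebra.
From mathcomp Require Import all_classical all_reals all_analysis.
From mathcomp Require Import ring lra.

Set Implicit Arguments.
Unset Strict Implicit.
Unset Printing Implicit Defensive.

Import Order.TTheory GRing.Theory Num.Theory.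
Local Open Scope ring_scope.

(** Write [mu i] for the mass [total_g g [set i]], [h] for the Cheeger constant,
    [c] and [C] for [const_c] and [const_C]. As the [g e] are additive, the
    denominator of the Rayleigh quotient of [x] is the least value over [t] of
    [D t = sum_i mu i * |x i - t| ^ p].

    The upper bound comes from testing with indicators of cuts [A]. The
    numerator is then [sum_e w e * f e A ^ p <= C * f A], while convexity of
    the power gives [D t >= 2 ^ (1 - p) * min (mu A) (mu (~: A))] for all [t].

    For the lower bound, let [t] be a weighted median of [x], and let
    [phi s = sign (s - t) * |s - t| ^ p]. For a set function [u] let
    [L phi u] be the integral of [u {x > s}] against [d phi s]
    ([level_sum]); it is the Lovász extension of [u] when [phi] is the
    identity and [u V = 0]. By the choice of the median, the smaller side of
    [{x > s}] is the one that does not contain the median, so that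
    [f {x > s} >= h * min (mu {x > s}) (mu {x <= s})] integrates to
    [h * D t <= L phi f = sum_e w e * L phi (f e)] ([level_sum_cheeger]).

    For one edge [e], with [V_e] its relevant vertices, the essential estimate
    is
    [L phi (f e) <= p * K_e ^ (1 - 1/p) * lovasz (f e) x], where
    [K_e = 1/2 * sum_(i in V_e) |x i - t| ^ p] ([level_sum_spowR_le]). The
    function [s |-> f e {x > s}] jumps only at values of [x] on [V_e], and
    between two distinct such values [a < b] a Hermite-Hadamard type
    inequality ([spowRB_le]) gives
    [phi b - phi a <= p * (b - a) * ((|a-t|^p + |b-t|^p) / 2) ^ (1 - 1/p)].
    Keeping both endpoints here, instead of the larger one, is what produces
    the factor [2 ^ (p - 1)].

    Finally Hölder's inequality over the edges, together with
    [sum_e w e * K_e <= c / 2 * D t], yields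
    [(h * D t) ^ p <= p ^ p * (sum_e w e * lovasz (f e) x ^ p) *
    (c / 2 * D t) ^ (p - 1)], and one divides by [D t ^ (p - 1)]. *)

(** * Power inequalities *)

Section PowerInequalities.
Context {R : realType}.
Implicit Types (a b p q t x y : R).

(** The case [a = 0], [b = 1] of [spowRB_le], with [q = 1 - 1/p]. It follows
    from [ln 2 <= 1] and [1 - q <= expR (- q)]. *)
Lemma powR2_le q : 0 <= q < 1 -> 2 `^ q * (1 - q) <= 1.
Proof.
move=> /andP[q0 q1].
have ln2 : ln 2 <= 1 :> R.
  by apply: (@le_ln1Dx R 1); rewrite (lt_trans _ ltr01)// oppr_lt0.
have two_le : 2 `^ q <= expR q.
  by rewrite /powR pnatr_eq0/= ler_expR ler_piMr.
have le_exp : 1 - q <= expR (- q) by exact: expR_ge1Dx.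
have expRV : expR q * expR (- q) = 1 by rewrite -expRD subrr expR0.
by rewrite -[leRHS]expRV ler_pM ?powR_ge0// subr_ge0 ltW.
Qed.

(** The midpoint inequality for the convex function [y |-> t * y `^ (t - 1)]
    on the interval of radius [x] around 1: the left side is the length of
    the interval times the value at its centre, the right side the integral.
    The derivative in [x] of the difference of the two sides has the sign of
    [(1 + x) `^ (t - 1) + (1 - x) `^ (t - 1) - 2], which is nonnegative
    because the two powers have product at least 1. *)
Lemma powR_1D1B_ge t x : 0 < t <= 1 -> 0 <= x <= 1 ->
  2 * t * x <= (1 + x) `^ t - (1 - x) `^ t.
Proof.
move=> /andP[t0 t1] /andP[x0 x1].
(* At [x = 1] the base [1 - x] vanishes, where [powR ^~ t] need not be
   differentiable. *)
have [->|xN1] := eqVneq x 1.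
  rewrite subrr powR0 ?gt_eqF// subr0 mulr1 -[1 + 1]/2.
  have := @powR2_le (1 - t); rewrite subKr => H.
  have {H} : 2 `^ (1 - t) * t <= 1 by apply: H; lra.
  rewrite (@powRB _ 2 1 t) ?pnatr_eq0 ?implybT// powRr1// mulrAC.
  by rewrite ler_pdivrMr ?powR_gt0// mul1r.
have {x1 xN1} x1 : x < 1 by rewrite lt_neqAle xN1.
pose h (y : R) := (1 + y) `^ t - (1 - y) `^ t - 2 * t * y.
have dh y : 0 <= y < 1 -> is_derive y 1 h
    (t * (1 + y) `^ (t - 1) + t * (1 - y) `^ (t - 1) - 2 * t).
  move=> /andP[y0 y1].
  have d1 : is_derive (1 + y) 1 (@powR R ^~ t) (t * (1 + y) `^ (t - 1)).
    by apply: is_derive1_powR; lra.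
  have d2 : is_derive (1 - y) 1 (@powR R ^~ t) (t * (1 - y) `^ (t - 1)).
    by apply: is_derive1_powR; lra.
  have e1 : is_derive y 1 (fun y : R => (1 + y) `^ t)
      (t * (1 + y) `^ (t - 1) * 1).
    apply: (@is_derive1_comp _ (@powR R ^~ t) (fun y : R => 1 + y)) => //.
    have := is_deriveD (is_derive_cst (1 : R) y (1 : R))
      (is_derive_id y (1 : R)).
    by rewrite add0r.
  have e2 : is_derive y 1 (fun y : R => (1 - y) `^ t)
      (t * (1 - y) `^ (t - 1) * -1).
    apply: (@is_derive1_comp _ (@powR R ^~ t) (fun y : R => 1 - y)) => //.
    have := is_deriveB (is_derive_cst (1 : R) y (1 : R))
      (is_derive_id y (1 : R)).
    by rewrite sub0r.
  have e3 : is_derive y 1 (fun y : R => 2 * t * y) (2 * t).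
    have := is_deriveZ (2 * t) (is_derive_id y (1 : R)).
    by rewrite /GRing.scale/= mulr1.
  have := is_deriveB (is_deriveB e1 e2) e3.
  by rewrite mulr1 mulrN1 opprK.
have dh_ge0 y : 0 <= y < 1 ->
    0 <= t * (1 + y) `^ (t - 1) + t * (1 - y) `^ (t - 1) - 2 * t.
  move=> /andP[y0 y1]; rewrite -mulrDr [2 * t]mulrC -mulrBr pmulr_rge0//.
  rewrite -[t - 1]opprB !powRN.
  set u := (1 + y) `^ (1 - t); set v := (1 - y) `^ (1 - t).
  have u0 : 0 < u by apply: powR_gt0; lra.
  have v0 : 0 < v by apply: powR_gt0; lra.
  have uv1 : u * v <= 1.
    have <- : 1 `^ (1 - t) = 1 :> R by rewrite powR1.
    rewrite /u /v -powRM; [|lra..].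
    by apply: ge0_ler_powR; rewrite ?nnegrE; nra.
  have -> : u^-1 + v^-1 - 2 = (u + v - 2 * (u * v)) / (u * v).
    by field; rewrite !gt_eqF.
  apply: divr_ge0; last by rewrite mulr_ge0 ?ltW.
  have := sqr_ge0 (u - v); nra.
have : h 0 <= h x.
  apply: (@ger0_derive1_ndecr _ h 0 x) => //.
  - move=> y; rewrite in_itv/= => /andP[y0 yx].
    by apply: ex_derive; apply: dh; lra.
  - move=> y; rewrite in_itv/= => /andP[y0 yx].
    have [|_ dhE] := dh y _; first lra.
    by rewrite derive1E dhE dh_ge0//; lra.
  - apply: derivable_within_continuous => y; rewrite in_itv/= => /andP[y0 yx].
    by apply: ex_derive; apply: dh; lra.
by rewrite /h addr0 subr0 subrr mulr0 subrr subr_ge0.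
Qed.

(** The left side is the integral of [p * s `^ (p - 1)] over [[a, b]]. By
    Jensen and the convexity of [s `^ p], the mean of [s `^ (p - 1)] is at most
    the power [(p - 1) / p] of the mean of [s `^ p] at the two endpoints.
    Substituting [z = s `^ p] turns this into the midpoint inequality
    [powR_1D1B_ge] with exponent [1 / p], scaled to the centre
    [m = (a `^ p + b `^ p) / 2]. *)
Lemma powRB_le p a b : 1 <= p -> 0 <= a <= b ->
  b `^ p - a `^ p <= p * (b - a) * ((a `^ p + b `^ p) / 2) `^ ((p - 1) / p).
Proof.
move=> p1 /andP[a0 ab].
have p0 : 0 < p by rewrite (lt_le_trans ltr01).
have b0 : 0 <= b by exact: le_trans ab.
have [->|aNb] := eqVneq a b; first by rewrite !subrr mulr0 mul0r.
have b_gt0 : 0 < b by rewrite (le_lt_trans a0)// lt_neqAle aNb.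
have bp0 : 0 < b `^ p by exact: powR_gt0.
have ap0 : 0 <= a `^ p by exact: powR_ge0.
have abp : a `^ p <= b `^ p by apply: ge0_ler_powR; rewrite ?nnegrE// ltW.
set m := (a `^ p + b `^ p) / 2.
have m0 : 0 < m by rewrite /m; lra.
pose x := (b `^ p - a `^ p) / 2 / m.
have x01 : 0 <= x <= 1.
  apply/andP; split.
    by apply: divr_ge0; [rewrite divr_ge0// subr_ge0|exact: ltW].
  by rewrite /x ler_pdivrMr// mul1r /m; lra.
have D1 : 1 + x = b `^ p / m by rewrite /x /m; field; rewrite gt_eqF//; lra.
have B1 : 1 - x = a `^ p / m by rewrite /x /m; field; rewrite gt_eqF//; lra.
have pV01 : 0 < p^-1 <= 1 by rewrite invr_gt0 p0 invf_le1.
have root c : 0 <= c -> (c `^ p / m) `^ p^-1 = c / m `^ p^-1.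
  move=> c0; rewrite powRM ?invr_ge0 ?powR_ge0 ?ltW//.
  rewrite -powRrM divff ?gt_eqF// powRr1//; congr (_ * _).
  by rewrite -[m^-1]powR_inv1 ?ltW// powRAC powR_inv1// powR_ge0.
have := powR_1D1B_ge pV01 x01; rewrite D1 B1 !root// => H.
have -> : (p - 1) / p = 1 - p^-1 by field; rewrite gt_eqF.
rewrite powRB; last by rewrite (gt_eqF m0) implybT.
rewrite powRr1 ?(ltW m0)//.
set r := m `^ p^-1 in H *.
have r0 : 0 < r by exact: powR_gt0.
have -> : b `^ p - a `^ p = p * m * (2 * p^-1 * x).
  by rewrite /x; field; rewrite !gt_eqF.
have -> : p * (b - a) * (m / r) = p * m * (b / r - a / r).
  by field; rewrite gt_eqF.
by rewrite ler_pM2l// mulr_gt0.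
Qed.

(** The odd extension of [x `^ p], a primitive of [p * `|x| `^ (p - 1)]. *)
Definition spowR p x := Num.sg x * `|x| `^ p.

Lemma spowRN p x : spowR p (- x) = - spowR p x.
Proof. by rewrite /spowR sgrN normrN mulNr. Qed.

Lemma spowR_ge0E p x : 0 < p -> 0 <= x -> spowR p x = x `^ p.
Proof.
move=> p0; rewrite le_eqVlt => /predU1P[<-|x0].
  by rewrite /spowR sgr0 mul0r powR0// gt_eqF.
by rewrite /spowR gtr0_sg// mul1r gtr0_norm.
Qed.

Lemma spowR0 p : spowR p 0 = 0.
Proof. by rewrite /spowR sgr0 mul0r. Qed.

Lemma normr_spowR p x : 0 < p -> `|spowR p x| = `|x| `^ p.
Proof.
move=> p0; have [->|xN0] := eqVneq x 0.
  by rewrite spowR0 normr0 powR0// gt_eqF.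
by rewrite /spowR normrM normr_sg xN0 mul1r ger0_norm// powR_ge0.
Qed.

Lemma spowR_homo p : 0 < p -> {homo spowR p : x y / x <= y}.
Proof.
move=> p0 a b ab.
have mono c d : 0 <= c -> c <= d -> spowR p c <= spowR p d.
  move=> c0 cd; have d0 := le_trans c0 cd; rewrite !spowR_ge0E//.
  exact: (ge0_ler_powR (ltW p0)).
have [a0|a0] := leP 0 a; first exact: mono.
have [b0|b0] := leP b 0.
  by rewrite -[leLHS]opprK -[leRHS]opprK lerN2 -!spowRN mono ?oppr_ge0 ?lerN2.
apply: (@le_trans _ _ 0).
  by rewrite -oppr_ge0 -spowRN spowR_ge0E ?powR_ge0// oppr_ge0 ltW.
by rewrite spowR_ge0E ?powR_ge0// ltW.
Qed.

Lemma powR_superadditive p a b : 1 <= p -> 0 <= a -> 0 <= b ->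
  a `^ p + b `^ p <= (a + b) `^ p.
Proof.
move=> p1 a0 b0; have p0 : 0 < p by rewrite (lt_le_trans ltr01).
rewrite -(mulr_powRB1 a0 p0) -(mulr_powRB1 b0 p0).
rewrite -(mulr_powRB1 (addr_ge0 a0 b0) p0) mulrDl.
by rewrite lerD// ler_wpM2l// ge0_ler_powR ?nnegrE ?subr_ge0 ?addr_ge0//; lra.
Qed.

(** On each side of 0 this is [powRB_le]. When [a < 0 < b], the left side is
    [S = `|a| `^ p + b `^ p], and superadditivity of the power gives
    [S `^ (1 / p) <= b - a]; the factor 2 lost in the mean is paid for by
    [powR2_le]. *)
Lemma spowRB_le p a b : 1 <= p -> a <= b ->
  spowR p b - spowR p a <=
  p * (b - a) * ((`|a| `^ p + `|b| `^ p) / 2) `^ ((p - 1) / p).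
Proof.
move=> p1 ab; have p0 : 0 < p by rewrite (lt_le_trans ltr01).
have [a0|a0] := leP 0 a.
  have b0 := le_trans a0 ab.
  by rewrite !spowR_ge0E// !ger0_norm// powRB_le// a0.
have [b0|b0] := leP b 0.
  have Na0 : 0 <= - a by rewrite oppr_ge0 ltW.
  have Nb0 : 0 <= - b by rewrite oppr_ge0.
  have -> : spowR p b - spowR p a = spowR p (- a) - spowR p (- b).
    by rewrite !spowRN opprK addrC.
  have -> : b - a = - a - - b by ring.
  rewrite -(normrN a) -(normrN b) !ger0_norm// !spowR_ge0E//.
  by rewrite [X in X / 2]addrC powRB_le// Nb0 lerN2.
rewrite -spowRN !spowR_ge0E ?oppr_ge0 ?(ltW a0) ?(ltW b0)//.
rewrite (ltr0_norm a0) (gtr0_norm b0) addrC.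
move: (- a) (oppr_gt0 a); rewrite a0 => {a a0 ab} a a0.
set S := a `^ p + b `^ p.
have S0 : 0 < S by rewrite addr_gt0// powR_gt0.
have := @powR_superadditive p a b p1 (ltW a0) (ltW b0); rewrite -/S => Sle.
have q01 : 0 <= (p - 1) / p < 1.
  apply/andP; split; first by rewrite divr_ge0 ?subr_ge0 ?(ltW p0).
  by rewrite ltr_pdivrMr// mul1r ltrBlDr ltrDl.
set q := (p - 1) / p in q01 *.
have pqE : 1 - q = p^-1 by rewrite /q; field; rewrite gt_eqF.
have rootS : S `^ p^-1 <= a + b.
  have -> : a + b = ((a + b) `^ p) `^ p^-1.
    by rewrite -powRrM divff ?gt_eqF// powRr1// addr_ge0// ltW.
  by rewrite ge0_ler_powR ?nnegrE ?powR_ge0 ?invr_ge0// ltW.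
have halfS : (S / 2) `^ q = S `^ q / 2 `^ q.
  rewrite powRM ?invr_ge0 ?(ltW S0)//; congr (_ * _).
  by rewrite -[2^-1]powR_inv1// powRAC powR_inv1// powR_ge0.
have S_split : S = S `^ p^-1 * S `^ q.
  by rewrite -powRD ?(gt_eqF S0) ?implybT// -pqE subrK powRr1// ltW.
have two_q := powR2_le q01; rewrite pqE ler_pdivrMr// mul1r in two_q.
have wq0 : 0 < 2 `^ q :> R by exact: powR_gt0.
rewrite [b + a]addrC -/S halfS.
have -> : p * (a + b) * (S `^ q / 2 `^ q) = (a + b) * S `^ q * (p / 2 `^ q).
  by ring.
rewrite [leLHS]S_split -[leLHS]mulr1 ler_pM ?mulr_ge0 ?powR_ge0//.
  by rewrite ler_wpM2r// powR_ge0.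
by rewrite ler_pdivlMr// mul1r.
Qed.
Lemma powRD_le p a b : 1 <= p -> 0 <= a -> 0 <= b ->
  (a + b) `^ p <= 2 `^ (p - 1) * (a `^ p + b `^ p).
Proof.
move=> p1 a0 b0.
have half_ge0 : 0 <= 2^-1 :> R by [].
have half_le1 : 2^-1 <= 1 :> R by rewrite invf_le1 ?ler1n.
have p0 : 0 < p by rewrite (lt_le_trans ltr01).
have half : 1 - 2^-1 = 2^-1 :> R by field.
have : (2^-1 * a + 2^-1 * b) `^ p <= 2^-1 * a `^ p + 2^-1 * b `^ p.
  rewrite -{2 4}half.
  by apply: (convex_powR p1 (Itv01 half_ge0 half_le1)) => /=;
    rewrite inE/= in_itv/= andbT.
rewrite -!mulrDr powRM ?addr_ge0 ?invr_ge0//.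
rewrite -[2^-1 in X in X -> _]powR_inv1// powRAC powR_inv1 ?powR_ge0//.
rewrite ler_pdivrMl ?powR_gt0// mulrA => /le_trans; apply.
by rewrite powR_inv1// powRB ?pnatr_eq0 ?implybT// powRr1.
Qed.

(** Hölder's inequality for finite weighted sums, with exponents [p] and
    [p / (p - 1)], raised to the power [p] so that it still makes sense for
    [p = 1]. The summands are compared by Young's inequality after dividing
    [F] and [K] by their norms. *)
Lemma powR_hoelder (I : finType) (w F K : I -> R) p : 1 <= p ->
  (forall i, 0 <= w i) -> (forall i, 0 <= F i) -> (forall i, 0 <= K i) ->
  (\sum_i w i * (F i * K i `^ ((p - 1) / p))) `^ p <=
  (\sum_i w i * F i `^ p) * (\sum_i w i * K i) `^ (p - 1).
Proof.
move=> p1 w0 F0 K0; have p0 : 0 < p by rewrite (lt_le_trans ltr01).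
have [->|pN1] := eqVneq p 1.
  rewrite subrr mul0r powRr0 mulr1 powRr1.
    by apply: ler_sum => i _; rewrite powRr0 mulr1 powRr1.
  by apply: sumr_ge0 => i _; rewrite !mulr_ge0// powR_ge0.
have {pN1} p_gt1 : 1 < p by rewrite lt_neqAle eq_sym pN1.
set q := (p - 1) / p.
have q0 : 0 < q by rewrite divr_gt0// subr_gt0.
have pqE : p^-1 + q = 1 by rewrite /q; field; rewrite gt_eqF.
set X := \sum_i w i * F i `^ p; set Y := \sum_i w i * K i.
have X0 : 0 <= X by apply: sumr_ge0 => i _; rewrite mulr_ge0// powR_ge0.
have Y0 : 0 <= Y by apply: sumr_ge0 => i _; rewrite mulr_ge0.
have zero : (forall i, w i * (F i * K i `^ q) = 0) ->
    (\sum_i w i * (F i * K i `^ q)) `^ p <= X * Y `^ (p - 1).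
  move=> h; rewrite big1 => [|i _]; last exact: h.
  by rewrite powR0 ?gt_eqF// mulr_ge0// powR_ge0.
have [X_eq0|X_neq0] := eqVneq X 0.
  apply: zero => i.
  have /eqP := X_eq0; rewrite psumr_eq0 => [/allP/(_ i)|j _]; last first.
    by rewrite mulr_ge0// powR_ge0.
  rewrite mem_index_enum mulf_eq0 powR_eq0 (gt_eqF p0) andbT => /(_ isT).
  by case/orP => /eqP ->; rewrite ?mul0r ?mulr0.
have [Y_eq0|Y_neq0] := eqVneq Y 0.
  apply: zero => i.
  have /eqP := Y_eq0; rewrite psumr_eq0 => [/allP/(_ i)|j _]; last first.
    by rewrite mulr_ge0.
  rewrite mem_index_enum mulf_eq0 => /(_ isT).
  by case/orP => /eqP ->; rewrite ?mul0r// powR0 ?gt_eqF// !mulr0.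
have {zero X_neq0} X_gt0 : 0 < X by rewrite lt_neqAle eq_sym X_neq0.
have {Y_neq0} Y_gt0 : 0 < Y by rewrite lt_neqAle eq_sym Y_neq0.
have rX0 : 0 < X `^ p^-1 by exact: powR_gt0.
have rY0 : 0 < Y `^ q by exact: powR_gt0.
have young i : F i * K i `^ q <=
    X `^ p^-1 * Y `^ q * (F i `^ p / X / p + K i / Y * q).
  have := @conjugate_powR R (F i / X `^ p^-1) ((K i / Y) `^ q) p q^-1.
  rewrite invr_gt0 invrK pqE => /(_ _ _ p0 q0 erefl).
  rewrite powR_ge0 divr_ge0 ?powR_ge0// => /(_ isT isT).
  rewrite -[((K i / Y) `^ q) `^ _]powRrM divff ?gt_eqF// powRr1; last first.
    by rewrite divr_ge0// ltW.
  have -> : (F i / X `^ p^-1) `^ p = F i `^ p / X.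
    rewrite -powR_inv1 ?powR_ge0// powRM ?powR_ge0//; congr (_ * _).
    by rewrite powRAC -(powRrM X) mulVf ?gt_eqF// powRr1
      ?powR_inv1 ?(ltW X_gt0).
  have -> : (K i / Y) `^ q = K i `^ q / Y `^ q.
    rewrite -powR_inv1 ?(ltW Y_gt0)// powRM ?powR_ge0//; congr (_ * _).
    by rewrite powRAC powR_inv1 ?powR_ge0.
  move=> H; rewrite -ler_pdivrMl ?mulr_gt0//; apply: le_trans H.
  by rewrite le_eqVlt; apply/orP; left; apply/eqP; field; rewrite !gt_eqF.
have sum_le : \sum_i w i * (F i * K i `^ q) <= X `^ p^-1 * Y `^ q.
  apply: (@le_trans _ _ (\sum_i X `^ p^-1 * Y `^ q *
      (w i * F i `^ p / X / p + w i * K i / Y * q))).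
    apply: ler_sum => i _; apply: le_trans (ler_wpM2l (w0 i) (young i)) _.
    by rewrite le_eqVlt; apply/orP; left; apply/eqP; ring.
  rewrite -big_distrr big_split/= -!mulr_suml -/X -/Y !divff ?gt_eqF//.
  by rewrite !mul1r pqE mulr1.
apply: (@le_trans _ _ ((X `^ p^-1 * Y `^ q) `^ p)).
  apply: ge0_ler_powR => //; rewrite ?nnegrE ?mulr_ge0 ?powR_ge0 ?(ltW p0)//.
  by apply: sumr_ge0 => i _; rewrite !mulr_ge0// powR_ge0.
rewrite powRM ?powR_ge0// -!powRrM mulVf ?gt_eqF// powRr1//.
by rewrite /q divfK ?gt_eqF.
Qed.

End PowerInequalities.

(** * Order statistics and level sums *)

Section OrderStatistics.
Context {R : realType} {V : finType}.
Implicit Types (x : V -> R) (psi : R -> R) (u : {set V} -> R) (t : R).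

Definition order_stats x : seq R := sort <=%R (codom x).

Definition superlevel x t : {set V} := [set j : V | t < x j]%SET.

(** The Stieltjes integral of [t |-> u (superlevel x t)] against [psi], over
    the range of [x]. For [psi = id] it is the Lovász extension, up to the term
    in [u V]. *)
Definition level_sum psi u x : R :=
  let s := order_stats x in
  \sum_(0 <= k < #|V|.-1) (psi s`_k.+1 - psi s`_k) * u (superlevel x s`_k).

Lemma lovaszE u x : lovasz u x =
  level_sum id u x + (order_stats x)`_0 * u ([set: V]%SET).
Proof. by []. Qed.

Lemma size_order_stats x : size (order_stats x) = #|V|.
Proof. by rewrite size_sort size_codom. Qed.

Lemma order_stats_le x j k : (j <= k < #|V|)%N ->
  (order_stats x)`_j <= (order_stats x)`_k.
Proof.
move=> /andP[jk kV]; apply: le_sorted_leq_nth => //.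
- exact: sort_le_sorted.
- by rewrite inE size_order_stats (leq_ltn_trans jk).
- by rewrite inE size_order_stats.
Qed.

Lemma order_statsP x i : exists2 k, (k < #|V|)%N & (order_stats x)`_k = x i.
Proof.
have : x i \in order_stats x by rewrite mem_sort codom_f.
by case/(nthP 0) => k; rewrite size_order_stats => kV <-; exists k.
Qed.

Lemma order_stats_attained x k : (k < #|V|)%N ->
  exists i, x i = (order_stats x)`_k.
Proof.
move=> kV; have : (order_stats x)`_k \in order_stats x.
  by rewrite mem_nth// size_order_stats.
by rewrite mem_sort => /codomP[i ->]; exists i.
Qed.

Lemma order_stats_gap x k i : (k < #|V|)%N ->
  (order_stats x)`_k < x i -> (order_stats x)`_k.+1 <= x i.
Proof.
move=> kV; have [j jV <-] := order_statsP x i => sk_lt.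
apply: order_stats_le; rewrite jV andbT ltnNge; apply/negP => jk.
by move: sk_lt; rewrite ltNge order_stats_le// jk.
Qed.

Lemma order_stats_first x i : (order_stats x)`_0 <= x i.
Proof.
by have [j jV <-] := order_statsP x i; exact: order_stats_le.
Qed.

Lemma order_stats_last x i : x i <= (order_stats x)`_(#|V|.-1).
Proof.
have [j jV <-] := order_statsP x i; apply: order_stats_le.
by case: #|V| jV => // n; rewrite !ltnS leqnn andbT.
Qed.

(** The increments of [psi] between consecutive order statistics are those of
    [psi] composed with the clamping onto [[x i, x j]], because no value of [x]
    lies strictly between two consecutive order statistics. *)
Lemma order_stats_telescope x psi i j : x i <= x j ->
  \sum_(0 <= k < #|V|.-1)
     (psi (order_stats x)`_k.+1 - psi (order_stats x)`_k) *
     (x i <= (order_stats x)`_k < x j)%R%:R = psi (x j) - psi (x i).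
Proof.
move=> xij; set s := order_stats x.
pose clamp t := Num.max (x i) (Num.min (x j) t).
have clampE t : x i <= t <= x j -> clamp t = t.
  by case/andP=> it tj; rewrite /clamp min_r// max_r.
have clamp_lo t : t <= x i -> clamp t = x i.
  by move=> ti; rewrite /clamp min_r ?(le_trans ti)// max_l.
have clamp_hi t : x j <= t -> clamp t = x j.
  by move=> jt; rewrite /clamp min_l// max_r.
rewrite (telescope_sumr_eq (fun k => psi (clamp s`_k))) => [||k /=]; first last.
- move=> kn; have kV : (k.+1 < #|V|)%N by rewrite -ltn_predRL.
  have sk : s`_k <= s`_k.+1 by rewrite order_stats_le// leqnSn.
  have [ski|iks] := ltP s`_k (x i).
    rewrite mulr0 (clamp_lo _ (ltW ski)) clamp_lo ?subrr//.
    by rewrite order_stats_gap// (ltn_trans _ kV).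
  have [skj|jks] := ltP s`_k (x j); last first.
    by rewrite mulr0 !clamp_hi ?subrr// (le_trans jks).
  have gap : s`_k.+1 <= x j by rewrite order_stats_gap// (ltn_trans _ kV).
  rewrite mulr1 (clampE s`_k) ?iks ?(ltW skj)//.
  by rewrite clampE// (le_trans iks sk) gap.
- by [].
- by rewrite clamp_hi ?order_stats_last// clamp_lo// order_stats_first.
Qed.

Lemma abel_summation (d F : nat -> R) n :
  \sum_(0 <= k < n) (d k.+1 - d k) * F k =
  d n * F n - d 0%N * F 0%N - \sum_(0 <= k < n) d k.+1 * (F k.+1 - F k).
Proof.
elim: n => [|n IH]; first by rewrite !big_geq// subr0 subrr.
by rewrite !big_nat_recr//= IH; ring.
Qed.

Lemma superlevel_last x : superlevel x (order_stats x)`_(#|V|.-1) = finset.set0.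
Proof.
by apply/setP => i; rewrite !inE ltNge order_stats_last.
Qed.

(** After summation by parts, the values of [psi] are multiplied by the jumps
    of [t |-> u (superlevel x t)], which occur only at values of [x]. *)
Lemma level_sum_eq0 psi u x :
  u finset.set0 = 0 -> u ([set: V]%SET) = 0 ->
  (forall i, psi (x i) = 0 \/
     u (superlevel x (x i)) = u ([set j : V | x i <= x j]%SET)) ->
  level_sum psi u x = 0.
Proof.
move=> u0 uT H; rewrite /level_sum; set s := order_stats x.
have [V0|V0] := posnP #|V|; first by rewrite V0 big_geq.
rewrite (abel_summation (fun k => psi s`_k) (fun k => u (superlevel x s`_k))).
rewrite superlevel_last u0 mulr0.
have -> : psi s`_0 * u (superlevel x s`_0) = 0.
  have [i xi] := order_stats_attained x V0; rewrite -/s in xi.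
  rewrite -xi; have [->|->] := H i; first by rewrite mul0r.
  rewrite (_ : [set j | _]%SET = [set: V]%SET) ?uT ?mulr0//.
  by apply/setP => j; rewrite !inE xi order_stats_first.
rewrite big_nat_cond big1 ?subrr// => k /andP[/andP[_ kn] _].
have kV : (k.+1 < #|V|)%N by rewrite -ltn_predRL.
have : s`_k <= s`_k.+1 by rewrite order_stats_le// leqnSn.
rewrite le_eqVlt => /predU1P[->|sk]; first by rewrite subrr mulr0.
have [i xi] := order_stats_attained x kV; rewrite -/s in xi.
rewrite -xi; have [->|->] := H i; first by rewrite mul0r.
rewrite (_ : [set j | _]%SET = superlevel x s`_k) ?subrr ?mulr0//.
apply/setP => j; rewrite !inE xi; apply/idP/idP => [|H1].
  exact: lt_le_trans.
by rewrite order_stats_gap// (ltn_trans _ kV).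
Qed.

Lemma level_sumB psi1 psi2 u x :
  level_sum (fun t => psi1 t - psi2 t) u x =
  level_sum psi1 u x - level_sum psi2 u x.
Proof.
by rewrite /level_sum -sumrB; apply: eq_bigr => k _; ring.
Qed.

Lemma level_sumZ c psi u x :
  level_sum (fun t => c * psi t) u x = c * level_sum psi u x.
Proof.
by rewrite /level_sum mulr_sumr; apply: eq_bigr => k _; ring.
Qed.

Lemma level_sum_homo_ge0 psi u x : {homo psi : a b / a <= b} ->
  (forall A, 0 <= u A) -> 0 <= level_sum psi u x.
Proof.
move=> hpsi u0; rewrite /level_sum big_nat_cond.
apply: sumr_ge0 => k /andP[/andP[_ kn] _].
have kV : (k.+1 < #|V|)%N by rewrite -ltn_predRL.
by rewrite mulr_ge0// subr_ge0 hpsi// order_stats_le// leqnSn.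
Qed.

(** For [u = f e] membership of [i] means [e \in incident f i]. *)
Definition relevant u : {set V} :=
  [set i : V | [exists S : {set V}, u (S :\ i)%SET != u S]]%SET.

Lemma irrelevant_setD u (D B : {set V}) :
  [disjoint D & relevant u] -> u (B :\: D)%SET = u B.
Proof.
elim: {D}_.+1 {-2}D (ltnSn #|D|) => // n IH D.
have [->|/set0Pn[i iD]] := eqVneq D finset.set0; first by rewrite finset.setD0.
rewrite ltnS => Dn dis.
have -> : (B :\: D)%SET = ((B :\: (D :\ i)) :\ i)%SET.
  apply/setP => j; rewrite !inE; case: (eqVneq j i) => //= ->.
  by rewrite iD.
have : i \notin relevant u by rewrite (disjointFr dis).
rewrite inE negb_exists => /forallP/(_ (B :\: (D :\ i))%SET).
rewrite negbK => /eqP ->; apply: IH.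
  by rewrite (cardsD1 i) iD in Dn.
by apply: disjointWl dis; exact: subD1set.
Qed.

(** The set function [u] only sees the coordinates in [relevant u], so the
    level sum is the same for any two [psi] that agree at the corresponding
    values of [x] ([level_sum_eq0]). Replacing [psi] by its nondecreasing
    envelope from those values makes every summand nonnegative. This is what
    allows an edge to ignore the order statistics that come from vertices
    outside of it. *)
Lemma level_sum_ge0 psi u x :
  (forall A, 0 <= u A) -> u finset.set0 = 0 -> u ([set: V]%SET) = 0 ->
  {in relevant u &, forall i j, x i <= x j -> psi (x i) <= psi (x j)} ->
  0 <= level_sum psi u x.
Proof.
move=> u_ge0 u0 uT mono.
(* Any lower bound for the relevant values of [psi] would do. *)
pose m := - \sum_i `|psi (x i)|.
pose psi' t := \big[Num.max/m]_(i in relevant u | x i <= t) psi (x i).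
have psi'_homo : {homo psi' : a b / a <= b}.
  move=> a b ab; apply: sub_bigmax => i /andP[-> xia] /=.
  exact: le_trans ab.
have psi'E i : i \in relevant u -> psi' (x i) = psi (x i).
  move=> iu; apply/eqP; rewrite eq_le; apply/andP; split.
    apply: bigmax_le => [|j /andP[ju ji]]; last exact: mono.
    rewrite /m lerNl (@le_trans _ _ `|psi (x i)|)//.
      by rewrite -normrN ler_norm.
    by rewrite (bigD1 i)//= lerDl sumr_ge0.
  by apply: (bigmax_sup i); rewrite ?iu ?lexx.
have -> : level_sum psi u x = level_sum psi' u x.
  apply/eqP; rewrite -subr_eq0 -level_sumB; apply/eqP.
  apply: level_sum_eq0 => // i.
  have [/existsP[j /andP[ju /eqP ji]]|nex] :=
      boolP [exists j, (j \in relevant u) && (x j == x i)].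
    by left; rewrite -ji psi'E// subrr.
  right; rewrite (_ : superlevel x (x i) =
      ([set j | x i <= x j] :\: [set j | x j == x i])%SET); last first.
    by apply/setP => j; rewrite !inE lt_neqAle eq_sym.
  apply: irrelevant_setD; apply/pred0P => j /=; apply/negbTE; rewrite inE.
  move: nex; rewrite negb_exists => /forallP/(_ j).
  by rewrite andbC.
exact: level_sum_homo_ge0.
Qed.

Lemma lovasz_additive u x :
  (forall A : {set V}, u A = \sum_(i in A) u ([set i]%SET)) ->
  lovasz u x = \sum_i u ([set i]%SET) * x i.
Proof.
move=> uD; rewrite lovaszE /level_sum; set s := order_stats x.
have [V0|V0] := posnP #|V|.
  rewrite V0 big_geq// uD !big1 ?mulr0 ?addr0// => i; by have := fintype0 i V0.
have [i0 xi0] := order_stats_attained x V0; rewrite -/s in xi0.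
have s0_le i : x i0 <= x i by rewrite xi0 order_stats_first.
have level k : (0 <= k < #|V|.-1)%N ->
    (s`_k.+1 - s`_k) * u (superlevel x s`_k) =
    \sum_i u ([set i]%SET) *
      ((s`_k.+1 - s`_k) * (x i0 <= s`_k < x i)%R%:R).
  move=> /= kn; rewrite uD big_mkcond mulr_sumr; apply: eq_bigr => i _.
  have -> : x i0 <= s`_k.
    by rewrite xi0 order_stats_le// (leq_trans kn)// leq_pred.
  by rewrite inE; case: ifP => _; rewrite ?mulr1 ?mulr0// mulrC.
rewrite (eq_big_nat _ _ level) exchange_big/= uD mulr_sumr.
rewrite [X in _ + X](_ : _ = \sum_i s`_0 * u ([set i]%SET)); last first.
  by apply: eq_bigl => i; rewrite inE.
rewrite -big_split/=; apply: eq_bigr => i _.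
by rewrite -mulr_sumr (@order_stats_telescope x id i0 i)// -xi0; ring.
Qed.

Lemma notin_exists (A : {set V}) : A != [set: V]%SET -> exists i, i \notin A.
Proof.
move=> AT; apply/existsP; rewrite -negb_forall.
by apply: contra AT => /forallP AT; apply/eqP/setP => i; rewrite inE AT.
Qed.

(** All order statistics are 0 or 1, so the only jump is from 0 to 1, at the
    superlevel set [A]. *)
Lemma lovasz_indicator u (A : {set V}) :
  A != finset.set0 -> A != [set: V]%SET ->
  u ([set: V]%SET) = 0 -> lovasz u (fun i => (i \in A)%:R) = u A.
Proof.
move=> A0 AT uT; rewrite lovaszE uT mulr0 addr0 /level_sum.
set x : V -> R := fun i => (i \in A)%:R; set s := order_stats x.
have x01 i : x i = 0 \/ x i = 1 by rewrite /x; case: (i \in A); [right|left].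
have [i iA] : exists i, i \in A by exact/set0Pn.
have [j jA] := notin_exists AT.
have xi : x i = 1 by rewrite /x iA.
have xj : x j = 0 by rewrite /x (negbTE jA).
have V0 : (0 < #|V|)%N by apply/card_gt0P; exists i.
have first : s`_0 = 0.
  have := order_stats_first x j; rewrite xj -/s.
  have [l] := order_stats_attained x V0; rewrite -/s => <-.
  by case: (x01 l) => -> //; rewrite ler10.
have last_ : s`_(#|V|.-1) = 1.
  have := order_stats_last x i; rewrite xi -/s.
  have [l] := @order_stats_attained x (#|V|.-1) ltac:(by rewrite ltn_predL).
  by rewrite -/s => <-; case: (x01 l) => -> //; rewrite ler10.
transitivity (\sum_(0 <= k < #|V|.-1) (s`_k.+1 - s`_k) * u A); last first.
  by rewrite -mulr_suml telescope_sumr// first last_ subr0 mul1r.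
apply: eq_big_nat => k /= kn.
have kV : (k.+1 < #|V|)%N by rewrite -ltn_predRL.
have : s`_k <= s`_k.+1 by rewrite order_stats_le// leqnSn.
rewrite le_eqVlt => /predU1P[->|sk]; first by rewrite subrr !mul0r.
have [l xl] := @order_stats_attained x k ltac:(exact: ltn_trans kV).
have [l' xl'] := order_stats_attained x kV.
rewrite -/s in xl xl'; rewrite -xl -xl' in sk *; congr (_ * u _).
have xl0 : x l = 0.
  by case: (x01 l) => // xl1; case: (x01 l') sk => ->; rewrite xl1 ?ltxx ?ltr10.
by apply/setP => m; rewrite inE xl0 /x; case: (m \in A); rewrite ?ltr01 ?ltxx.
Qed.

(** A weighted median: the vertex where [x] is least among those above which
    there is at most half of the mass. *)
Lemma median_exists x (mu : V -> R) : (0 < #|V|)%N -> (forall i, 0 <= mu i) ->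
  exists i0, (forall t, x i0 <= t ->
      \sum_(i in superlevel x t) mu i <= \sum_(i in ~: superlevel x t) mu i) /\
    (forall i, x i < x i0 ->
      \sum_(j in ~: superlevel x (x i)) mu j <=
      \sum_(j in superlevel x (x i)) mu j).
Proof.
move=> V0 mu0; have /card_gt0P[z _] := V0.
pose M (A : {set V}) := \sum_(i in A) mu i.
pose P i := M (superlevel x (x i)) <= M (~: superlevel x (x i)).
have Mmono (A B : {set V}) : A \subset B -> M A <= M B.
  move=> AB; rewrite /M [leRHS](big_setID A)/= (finset.setIidPr AB) lerDl.
  by apply: sumr_ge0.
have [top topV] :=
  @order_stats_attained x (#|V|.-1) ltac:(by rewrite ltn_predL).
have Ptop : P top.
  by rewrite /P topV superlevel_last /M big_set0 sumr_ge0.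
case: (@arg_minP _ _ _ top P x Ptop) => i0 Pi0 min_i0.
exists i0; split=> [t t0|i it].
  have sub : superlevel x t \subset superlevel x (x i0).
    by apply/fintype.subsetP => i; rewrite !inE; exact: le_lt_trans.
  apply: le_trans (Mmono _ _ sub) _; apply: le_trans Pi0 _.
  by apply: Mmono; rewrite finset.setCS.
apply: ltW; rewrite ltNge; apply/negP => Pi.
by have := min_i0 i Pi; rewrite leNgt it.
Qed.

(** The coarea argument. Above the median the smaller side of a superlevel set
    is the set itself, below the median it is its complement. Exchanging the
    sums over levels and vertices, each vertex contributes the increments of
    [psi] between its value and the median, which telescope. *)
Lemma level_sum_cheeger x (mu : V -> R) u (h : R) :
  (0 < #|V|)%N -> (forall i, 0 <= mu i) -> 0 <= h ->
  (forall A : {set V},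
     h * Num.min (\sum_(i in A) mu i) (\sum_(i in ~: A) mu i) <= u A) ->
  exists i0, forall psi, {homo psi : a b / a <= b} ->
    h * \sum_i mu i * `|psi (x i) - psi (x i0)| <= level_sum psi u x.
Proof.
move=> V0 mu0 h0 hu; have [i0 [hi lo]] := median_exists x V0 mu0.
exists i0 => psi homo; set s := order_stats x.
(* [chi k i] says that the level [k] separates [x i] from the median [x i0]. *)
pose chi k i := if x i0 <= s`_k then s`_k < x i else x i <= s`_k.
have dist i : `|psi (x i) - psi (x i0)| =
    \sum_(0 <= k < #|V|.-1) (psi s`_k.+1 - psi s`_k) * (chi k i)%:R.
  have [ii|/ltW ii] := leP (x i0) (x i).
    rewrite ger0_norm ?subr_ge0 ?homo// -(@order_stats_telescope x psi i0 i)//.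
    apply: eq_bigr => k _; congr (_ * (nat_of_bool _)%:R); rewrite /chi -/s.
    case: (leP (x i0) s`_k) => //= si; apply/esym/negbTE; rewrite -ltNge.
    exact: lt_le_trans ii.
  rewrite ler0_norm ?subr_le0 ?homo// opprB.
  rewrite -(@order_stats_telescope x psi i i0)//.
  apply: eq_bigr => k _; congr (_ * (nat_of_bool _)%:R); rewrite /chi -/s.
  rewrite ltNge andbC.
  case: (leP (x i0) s`_k) => //= si; apply/esym/negbTE; rewrite -leNgt.
  exact: le_trans si.
under eq_bigr do rewrite dist mulr_sumr.
rewrite exchange_big/= mulr_sumr /level_sum -/s.
apply: ler_sum_nat => k /= kn.
have kV : (k.+1 < #|V|)%N by rewrite -ltn_predRL.
have dpsi : 0 <= psi s`_k.+1 - psi s`_k.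
  by rewrite subr_ge0 homo// order_stats_le// leqnSn.
rewrite (eq_bigr (fun i => (psi s`_k.+1 - psi s`_k) * (mu i * (chi k i)%:R)));
  last by move=> i _; ring.
rewrite -mulr_sumr mulrCA ler_wpM2l//; apply: le_trans (hu _).
rewrite ler_wpM2l//.
have [l xl] := @order_stats_attained x k ltac:(exact: ltn_trans kV).
rewrite -/s in xl; rewrite le_min.
have [i0k|ki0] := leP (x i0) s`_k.
  suff -> : \sum_i mu i * (chi k i)%:R = \sum_(i in superlevel x s`_k) mu i.
    by rewrite lexx hi.
  rewrite [RHS]big_mkcond; apply: eq_bigr => i _; rewrite /chi i0k inE.
  by case: ifP => _; rewrite ?mulr1 ?mulr0.
suff -> : \sum_i mu i * (chi k i)%:R = \sum_(i in ~: superlevel x s`_k) mu i.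
  by rewrite lexx -xl lo// xl.
rewrite [RHS]big_mkcond; apply: eq_bigr => i _.
rewrite /chi leNgt ki0 !inE -leNgt.
by case: ifP => _; rewrite ?mulr1 ?mulr0.
Qed.

End OrderStatistics.

(** * Weighted deviations and the estimate of one edge *)

Section WeightedDeviation.
Context {R : realType} {V : finType}.
Implicit Types (x : V -> R) (t p : R) (mu : V -> R) (A B : {set V}).

(** Only the vertices of [A] and [B] are kept, both masses are replaced by the
    smaller one, and then the function of [t] is least at the midpoint of [a]
    and [b], by convexity of the power. *)
Lemma deviation_ge p mu x A B (a b t : R) : 1 <= p -> (forall i, 0 <= mu i) ->
  [disjoint A & B] -> (forall i, i \in A -> x i = a) ->
  (forall i, i \in B -> x i = b) ->
  Num.min (\sum_(i in A) mu i) (\sum_(i in B) mu i) *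
    (`|a - b| `^ p / 2 `^ (p - 1)) <= \sum_i mu i * `|x i - t| `^ p.
Proof.
move=> p1 mu0 AB xA xB.
have p0 : 0 < p by rewrite (lt_le_trans ltr01).
have two0 : 0 < 2 `^ (p - 1) :> R by exact: powR_gt0.
have part (C : {set V}) (c : R) : (forall i, i \in C -> x i = c) ->
    \sum_(i in C) mu i * `|x i - t| `^ p = (\sum_(i in C) mu i) * `|c - t| `^ p.
  by move=> xC; rewrite mulr_suml; apply: eq_bigr => i /xC ->.
apply: (@le_trans _ _ (\sum_(i in A :|: B) mu i * `|x i - t| `^ p)); last first.
  rewrite big_mkcond; apply: ler_sum => i _; case: ifP => // _.
  by rewrite mulr_ge0// powR_ge0.
have -> : \sum_(i in A :|: B) mu i * `|x i - t| `^ p =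
    \sum_(i in [predU A & B]) mu i * `|x i - t| `^ p.
  by apply: eq_bigl => i; rewrite !inE.
rewrite bigU//= (part _ _ xA) (part _ _ xB).
set mA := \sum_(i in A) _; set mB := \sum_(i in B) _.
apply: (@le_trans _ _ (Num.min mA mB * (`|a - t| `^ p + `|b - t| `^ p))).
  rewrite ler_wpM2l ?le_min ?sumr_ge0// ler_pdivrMr// mulrC.
  apply: le_trans (powRD_le _ _ _) => //.
  apply: ge0_ler_powR; rewrite ?nnegrE ?addr_ge0 ?(ltW p0)//.
  by rewrite -[in leRHS](distrC t b) (le_trans _ (ler_normD _ _))// addrA subrK.
by rewrite mulrDr lerD// ler_wpM2r ?powR_ge0// ge_min lexx ?orbT.
Qed.

(** The estimate for one edge: on the values of [x] at relevant vertices,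
    [spowR p (s - t)] grows at most at the rate [p * K `^ ((p - 1) / p)], where
    [K] is half the sum of the relevant deviations. Indeed [spowRB_le] bounds
    the increment between two such values by the mean of just two of these
    deviations. So [level_sum_ge0] applies to the difference. *)
Lemma level_sum_spowR_le p (u : {set V} -> R) x t : 1 <= p ->
  (forall A, 0 <= u A) -> u finset.set0 = 0 -> u ([set: V]%SET) = 0 ->
  level_sum (fun s => spowR p (s - t)) u x <=
  p * (lovasz u x *
    ((\sum_(i in relevant u) `|x i - t| `^ p) / 2) `^ ((p - 1) / p)).
Proof.
move=> p1 u_ge0 u0 uT.
have p0 : 0 < p by rewrite (lt_le_trans ltr01).
set K := (\sum_(i in relevant u) _) / 2; set c := K `^ _.
suff : 0 <= level_sum (fun s => p * c * id s - spowR p (s - t)) u x.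
  rewrite level_sumB level_sumZ subr_ge0 lovaszE uT mulr0 addr0.
  by rewrite -mulrA [c * _]mulrC.
apply: level_sum_ge0 => // i j iu ju; rewrite le_eqVlt => /predU1P[->//|ij].
have nij : j != i by apply: contraTneq ij => ->; rewrite ltxx.
have tij : x i - t <= x j - t by rewrite lerD2r ltW.
have := spowRB_le p1 tij; rewrite opprB addrA subrK => bound.
suff : spowR p (x j - t) - spowR p (x i - t) <= p * c * (x j - x i) by lra.
apply: le_trans bound _; rewrite mulrAC ler_wpM2r ?subr_ge0 ?(ltW ij)//.
rewrite ler_wpM2l ?(ltW p0)//; apply: ge0_ler_powR.
- by rewrite divr_ge0 ?subr_ge0 ?(ltW p0).
- by rewrite nnegrE divr_ge0// addr_ge0// powR_ge0.
- by rewrite nnegrE divr_ge0// sumr_ge0// => l _; rewrite powR_ge0.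
rewrite ler_pM2r// (bigD1 i)//= (bigD1 j)/= ?ju//.
by rewrite addrA lerDl sumr_ge0// => l _; rewrite powR_ge0.
Qed.

End WeightedDeviation.

(** * The Cheeger inequality *)

Section CheegerInequality.
Context {R : realType} {V E : finType}.
Context (w : E -> R) (f g : E -> {set V} -> R).
Context (w_gt0 : forall e, 0 < w e)
  (f_ge0 : forall e A, 0 <= f e A)
  (f_set0 : forall e, f e finset.set0 = 0)
  (f_setT : forall e, f e ([set: V]%SET) = 0)
  (g_additive :
     forall e (A : {set V}), g e A = \sum_(i in A) g e ([set i]%SET))
  (g_gt0 : forall i, 0 < total_g g ([set i]%SET))
  (V_gt1 : (1 < #|V|)%N).

Implicit Types (p t : R) (x : V -> R) (A : {set V}).

Local Notation mu := (fun i => total_g g ([set i]%SET)).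

Definition deviation p x t : R := \sum_i mu i * `|x i - t| `^ p.

Definition lovasz_energy p x : R := \sum_(e : E) w e * lovasz (f e) x `^ p.

Let mu_ge0 i : 0 <= mu i. Proof. exact: ltW. Qed.

Lemma total_gE A : total_g g A = \sum_(i in A) mu i.
Proof.
by rewrite exchange_big; apply: eq_bigr => e _; exact: g_additive.
Qed.

Lemma total_g_gt0 A : A != finset.set0 -> 0 < total_g g A.
Proof.
case/set0Pn => i iA; rewrite total_gE (bigD1 i)//= ltr_wpDr// sumr_ge0//.
Qed.

Lemma total_f_ge0 A : 0 <= total_f w f A.
Proof. by apply: sumr_ge0 => e _; rewrite mulr_ge0// ltW. Qed.

Lemma lovasz_ge0 e x : 0 <= lovasz (f e) x.
Proof.
by rewrite lovaszE f_setT mulr0 addr0 level_sum_homo_ge0.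
Qed.

Lemma lovasz_energy_ge0 p x : 0 <= lovasz_energy p x.
Proof. by apply: sumr_ge0 => e _; rewrite mulr_ge0 ?powR_ge0// ltW. Qed.

Lemma deviation_ge0 p x t : 0 <= deviation p x t.
Proof. by apply: sumr_ge0 => i _; rewrite mulr_ge0 ?powR_ge0. Qed.

Lemma sum_lovasz_deviation p x t :
  \sum_(e : E) lovasz (g e) (fun i => `|x i - t| `^ p) = deviation p x t.
Proof.
under eq_bigr => e _ do rewrite lovasz_additive//.
by rewrite exchange_big; apply: eq_bigr => i _; rewrite -mulr_suml.
Qed.

Lemma min_deviation_le p x t : min_deviation g p x <= deviation p x t.
Proof.
apply: ge_inf; last by exists t => //; exact: sum_lovasz_deviation.
by exists 0 => _ [s _ <-]; rewrite sum_lovasz_deviation deviation_ge0.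
Qed.

Lemma min_deviation_ge p x (c : R) : (forall t, c <= deviation p x t) ->
  c <= min_deviation g p x.
Proof.
move=> H; apply: lb_le_inf.
  by exists (\sum_(e : E) lovasz (g e) (fun i => `|x i - 0| `^ p)); exists 0.
by move=> _ [s _ <-]; rewrite sum_lovasz_deviation.
Qed.

Lemma min_deviation_gt0 p x : 1 <= p -> nonconstant x ->
  0 < min_deviation g p x.
Proof.
move=> p1 [i [j xij]].
pose c := Num.min (mu i) (mu j) * (`|x i - x j| `^ p / 2 `^ (p - 1)).
have c0 : 0 < c.
  by rewrite mulr_gt0 ?lt_min ?g_gt0// divr_gt0// powR_gt0// normr_gt0 subr_eq0.
apply: lt_le_trans c0 _; apply: min_deviation_ge => t.
have := @deviation_ge _ _ p mu x [set i]%SET [set j]%SET (x i) (x j) t p1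
  mu_ge0.
rewrite !big_set1; apply.
- by rewrite disjoints1 inE; apply: contra_neq xij => ->.
- by move=> k /[!inE] /eqP ->.
- by move=> k /[!inE] /eqP ->.
Qed.

Lemma cheeger_lbound : has_lbound
  [set total_f w f A / Num.min (total_g g A) (total_g g (~: A)%SET)
  | A in [set A : {set V} | A != finset.set0 /\ A != [set: V]%SET]%classic
  ]%classic.
Proof.
exists 0 => _ [A _ <-]; rewrite divr_ge0 ?total_f_ge0//.
by rewrite le_min !total_gE !sumr_ge0.
Qed.

Lemma cheeger_le A : A != finset.set0 -> A != [set: V]%SET ->
  cheeger w f g <= total_f w f A / Num.min (total_g g A) (total_g g (~: A)%SET).
Proof. by move=> A0 AT; apply: ge_inf; [exact: cheeger_lbound|exists A]. Qed.

Lemma min_total_g_gt0 A : A != finset.set0 -> A != [set: V]%SET ->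
  0 < Num.min (total_g g A) (total_g g (~: A)%SET).
Proof.
move=> A0 AT; rewrite lt_min !total_g_gt0//.
by apply: contra AT => /eqP H; rewrite -[A]finset.setCK H finset.setC0.
Qed.

Lemma total_f_ge_cheeger A :
  cheeger w f g * Num.min (\sum_(i in A) mu i) (\sum_(i in ~: A) mu i) <=
  total_f w f A.
Proof.
have [->|A0] := eqVneq A finset.set0.
  rewrite big_set0 min_l ?mulr0 ?total_f_ge0//.
  by rewrite sumr_ge0.
have [->|AT] := eqVneq A [set: V]%SET.
  by rewrite finset.setCT big_set0 min_r ?sumr_ge0// mulr0 total_f_ge0.
rewrite -!total_gE -ler_pdivlMr ?cheeger_le//.
exact: min_total_g_gt0.
Qed.

Lemma cut_exists : exists A : {set V}, A != finset.set0 /\ A != [set: V]%SET.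
Proof.
have [i _] : exists i, i \in V by apply/card_gt0P; exact: ltnW.
exists [set i]%SET; split; first by apply/set0Pn; exists i; rewrite inE.
by apply/eqP => H; move: V_gt1; rewrite -cardsT -H cards1.
Qed.

Lemma cheeger_ge (c : R) :
  (forall A, A != finset.set0 -> A != [set: V]%SET ->
    c <= total_f w f A / Num.min (total_g g A) (total_g g (~: A)%SET)) ->
  c <= cheeger w f g.
Proof.
move=> H; apply: lb_le_inf => [|_ [A [A0 AT] <-]]; last exact: H.
have [A AP] := cut_exists.
exists (total_f w f A / Num.min (total_g g A) (total_g g (~: A)%SET)).
by exists A.
Qed.

Lemma cheeger_ge0 : 0 <= cheeger w f g.
Proof.
apply: cheeger_ge => A A0 AT.
by rewrite divr_ge0 ?total_f_ge0// ltW// min_total_g_gt0.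
Qed.

Lemma const_c_ge0 : 0 <= const_c w f g.
Proof. exact: bigmax_ge_id. Qed.

Lemma const_cP i : \sum_(e in incident f i) w e <= const_c w f g * mu i.
Proof. by rewrite -ler_pdivrMr//; exact: le_bigmax. Qed.

Lemma const_C_ge0 p : 0 <= const_C f p.
Proof. exact: bigmax_ge_id. Qed.

Lemma const_CP p e A : f e A `^ (p - 1) <= const_C f p.
Proof.
apply: le_trans (le_bigmax _ _ e).
exact: (le_bigmax _ (fun A => f e A `^ (p - 1))).
Qed.

(** Exchanging the sums over edges and vertices turns the left side into the
    sum of the deviations, each weighted by half of the total weight of the
    edges incident to its vertex. *)
Lemma weighted_edge_deviation p x t :
  \sum_e w e * ((\sum_(i in relevant (f e)) `|x i - t| `^ p) / 2) <=
  const_c w f g / 2 * deviation p x t.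
Proof.
have -> : \sum_e w e * ((\sum_(i in relevant (f e)) `|x i - t| `^ p) / 2) =
    2^-1 * \sum_i `|x i - t| `^ p * \sum_(e in incident f i) w e.
  rewrite mulr_sumr.
  transitivity (\sum_e \sum_i 2^-1 *
      (`|x i - t| `^ p * (if e \in incident f i then w e else 0))).
    apply: eq_bigr => e _; rewrite mulr_suml mulr_sumr big_mkcond.
    by apply: eq_bigr => i _; rewrite !inE; case: ifP => _; ring.
  rewrite exchange_big; apply: eq_bigr => i _/=.
  by rewrite [\sum_(e in _) _]big_mkcond !mulr_sumr.
rewrite mulrAC mulrC ler_pM2r// /deviation mulr_sumr; apply: ler_sum => i _.
by rewrite mulrA [leRHS]mulrC ler_wpM2l ?powR_ge0// const_cP.
Qed.

(** With [t] a median of [x], the coarea bound for [spowR p (s - t)] is followed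
    by the estimate of each edge, by Hölder over the edges and by
    [weighted_edge_deviation]. *)
Lemma cheeger_deviation_le p x : 1 <= p ->
  exists t, (cheeger w f g * deviation p x t) `^ p <=
    p `^ p * (lovasz_energy p x *
      (const_c w f g / 2 * deviation p x t) `^ (p - 1)).
Proof.
move=> p1; have p0 : 0 < p by rewrite (lt_le_trans ltr01).
have [i0 H] :=
  level_sum_cheeger x (ltnW V_gt1) mu_ge0 cheeger_ge0 total_f_ge_cheeger.
exists (x i0); set t := x i0 in H *.
pose K e := (\sum_(i in relevant (f e)) `|x i - t| `^ p) / 2.
have K0 e : 0 <= K e.
  by rewrite divr_ge0// sumr_ge0// => i _; rewrite powR_ge0.
have spow_homo : {homo (fun s => spowR p (s - t)) : a b / a <= b}.
  by move=> a b ab; rewrite spowR_homo// lerD2r.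
have coarea : cheeger w f g * deviation p x t <=
    p * \sum_e w e * (lovasz (f e) x * K e `^ ((p - 1) / p)).
  have := H _ spow_homo; rewrite subrr.
  under eq_bigr => i _.
    rewrite (_ : `|_| = `|x i - t| `^ p); last first.
      by rewrite spowR0 subr0 normr_spowR.
    over.
  move=> /le_trans; apply.
  have -> : level_sum (fun s => spowR p (s - t)) (total_f w f) x =
      \sum_e w e * level_sum (fun s => spowR p (s - t)) (f e) x.
    rewrite /level_sum; under [RHS]eq_bigr => e _ do rewrite mulr_sumr.
    rewrite [RHS]exchange_big; apply: eq_bigr => k _.
    by rewrite mulr_sumr; apply: eq_bigr => e _; rewrite mulrCA.
  rewrite mulr_sumr; apply: ler_sum => e _.
  rewrite mulrCA ler_pM2l//; exact: level_sum_spowR_le.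
apply: (@le_trans _ _
    ((p * \sum_e w e * (lovasz (f e) x * K e `^ ((p - 1) / p))) `^ p)).
  apply: ge0_ler_powR => //; first exact: ltW.
  - by rewrite nnegrE mulr_ge0 ?cheeger_ge0 ?deviation_ge0.
  - rewrite nnegrE mulr_ge0 ?(ltW p0)// sumr_ge0// => e _.
    by rewrite !mulr_ge0 ?powR_ge0 ?lovasz_ge0 ?ltW.
rewrite powRM ?(ltW p0)//; last first.
  by rewrite sumr_ge0// => e _; rewrite !mulr_ge0 ?powR_ge0 ?lovasz_ge0 ?ltW.
rewrite ler_wpM2l ?powR_ge0//.
apply: le_trans
  (powR_hoelder p1 (fun e => ltW (w_gt0 e)) (lovasz_ge0 ^~ x) K0) _.
rewrite ler_wpM2l ?lovasz_energy_ge0//.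
apply: ge0_ler_powR; rewrite ?subr_ge0//.
- by rewrite nnegrE sumr_ge0// => e _; rewrite mulr_ge0 ?(ltW (w_gt0 e))// K0.
- by rewrite nnegrE mulr_ge0 ?deviation_ge0// divr_ge0// const_c_ge0.
exact: weighted_edge_deviation.
Qed.

(** Cancelling [deviation p x t `^ (p - 1)] in [cheeger_deviation_le] leaves
    [h ^ p / p ^ p * deviation <= energy * (c / 2) ^ (p - 1)], for one [t], and
    the least deviation is no larger. *)
Lemma rayleigh_ge p x : 1 <= p -> nonconstant x ->
  (2 / const_c w f g) `^ (p - 1) * (cheeger w f g `^ p / p `^ p) <=
  lovasz_energy p x / min_deviation g p x.
Proof.
move=> p1 xN; have p0 : 0 < p by rewrite (lt_le_trans ltr01).
have m0 := min_deviation_gt0 p1 xN.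
set c := const_c w f g; set h := cheeger w f g.
have c0 : 0 <= c := const_c_ge0.
have h0 : 0 <= h := cheeger_ge0.
set L := (2 / c) `^ (p - 1) * _.
have L0 : 0 <= L by rewrite mulr_ge0 ?divr_ge0 ?powR_ge0.
rewrite ler_pdivlMr//.
have [t bound] := cheeger_deviation_le x p1; rewrite -/c -/h in bound.
have D0 : 0 < deviation p x t := lt_le_trans m0 (min_deviation_le p x t).
apply: (@le_trans _ _ (L * deviation p x t)).
  by rewrite ler_wpM2l ?min_deviation_le.
set D := deviation p x t in bound D0 *; set N := lovasz_energy p x in bound *.
have pp0 : 0 < p `^ p by exact: powR_gt0.
have Dp0 : 0 < D `^ (p - 1) by exact: powR_gt0.
move: bound; rewrite powRM ?(ltW D0)// -(mulr_powRB1 (ltW D0) p0).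
rewrite powRM ?(ltW D0) ?divr_ge0// => bound.
have {bound} bound : h `^ p / p `^ p * D <= N * (c / 2) `^ (p - 1).
  rewrite mulrAC ler_pdivrMr// -(ler_pM2r Dp0).
  by apply: le_trans (le_trans bound _); rewrite le_eqVlt;
    apply/orP; left; apply/eqP; ring.
(* Here [2 / 0 = 0], and [0 `^ (p - 1)] is 1 or 0 as [p = 1] or not. *)
have [cE|cN0] := eqVneq c 0.
  have [pE|pN1] := eqVneq p 1.
    move: bound; rewrite /L pE subrr !powRr0 mul1r mulr1.
    done.
  rewrite /L cE invr0 mulr0 powR0 ?subr_eq0// !mul0r.
  exact: lovasz_energy_ge0.
have inv : (2 / c) `^ (p - 1) * (c / 2) `^ (p - 1) = 1.
  rewrite -powRM ?divr_ge0//.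
  by rewrite mulrA divfK ?divff ?powR1.
rewrite /L -mulrA; apply: le_trans (ler_wpM2l (powR_ge0 _ _) bound) _.
by rewrite mulrCA inv mulr1.
Qed.

Lemma lambda2_ge (p c : R) :
  (forall x, nonconstant x -> c <= lovasz_energy p x / min_deviation g p x) ->
  c <= lambda2 w f g p.
Proof.
move=> H; apply: lb_le_inf => [|_ [x xN <-]]; last exact: H.
have /card_gt1P[i [j [_ _ ij]]] := V_gt1.
pose x (k : V) : R := (k == i)%:R.
exists (lovasz_energy p x / min_deviation g p x); exists x => //.
by exists i, j; rewrite /x eqxx (eq_sym j) (negbTE ij) oner_neq0.
Qed.

Lemma lambda2_le p x : 1 <= p -> nonconstant x ->
  lambda2 w f g p <= lovasz_energy p x / min_deviation g p x.
Proof.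
move=> p1 xN; apply: ge_inf; last by exists x.
exists 0 => _ [y yN <-].
by rewrite divr_ge0 ?lovasz_energy_ge0// ltW// min_deviation_gt0.
Qed.

(** The test function is the indicator of [A]: its Lovász extensions are the
    [f e A], and [f e A `^ p] is [f e A] times at most [const_C]; its deviation
    is bounded below by [deviation_ge] with the values 1 on [A] and 0 off it. *)
Lemma lambda2_le_cut p A : 1 <= p -> A != finset.set0 -> A != [set: V]%SET ->
  lambda2 w f g p <= 2 `^ (p - 1) * const_C f p *
    (total_f w f A / Num.min (total_g g A) (total_g g (~: A)%SET)).
Proof.
move=> p1 A0 AT; have p0 : 0 < p by rewrite (lt_le_trans ltr01).
pose x (i : V) : R := (i \in A)%:R.
have xN : nonconstant x.
  have [i iA] : exists i, i \in A by exact/set0Pn.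
  have [j jA] := notin_exists AT.
  by exists i, j; rewrite /x iA (negbTE jA) oner_neq0.
apply: le_trans (lambda2_le p1 xN) _.
have mA0 := min_total_g_gt0 A0 AT.
set m := Num.min _ _ in mA0 *.
have two0 : 0 < 2 `^ (p - 1) :> R by exact: powR_gt0.
have dev : m / 2 `^ (p - 1) <= min_deviation g p x.
  apply: min_deviation_ge => t.
  have := @deviation_ge _ _ p mu x A (~: A)%SET 1 0 t p1 mu_ge0.
  rewrite subr0 normr1 powR1 mul1r -!total_gE; apply.
  - by rewrite -setI_eq0 finset.setICr.
  - by move=> i iA; rewrite /x iA.
  - by move=> i; rewrite inE => /negbTE iA; rewrite /x iA.
have num : lovasz_energy p x <= const_C f p * total_f w f A.
  rewrite /lovasz_energy /total_f mulr_sumr; apply: ler_sum => e _.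
  rewrite lovasz_indicator// mulrCA ler_pM2l// -mulr_powRB1// mulrC.
  by rewrite ler_wpM2r// const_CP.
rewrite ler_pdivrMr ?min_deviation_gt0//; apply: le_trans num _.
apply: le_trans (ler_wpM2l _ dev); last first.
  by rewrite !mulr_ge0 ?powR_ge0 ?const_C_ge0 ?total_f_ge0// invr_ge0 ltW.
by rewrite le_eqVlt; apply/orP; left; apply/eqP; field; rewrite !gt_eqF.
Qed.

(** [cheeger] is an infimum, so the bound of [lambda2_le_cut] can be divided by
    its constant, unless this is 0, where any cut gives the claim. *)
Lemma lambda2_le_cheeger p : 1 <= p ->
  lambda2 w f g p <= 2 `^ (p - 1) * const_C f p * cheeger w f g.
Proof.
move=> p1; set c := 2 `^ (p - 1) * _.
have : 0 <= c by rewrite mulr_ge0 ?powR_ge0 ?const_C_ge0.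
rewrite le_eqVlt => /predU1P[c0|c0].
  have [A [A0 AT]] := cut_exists.
  by have := lambda2_le_cut p1 A0 AT; rewrite -/c -c0 !mul0r.
rewrite -ler_pdivrMl//; apply: cheeger_ge => A A0 AT.
by rewrite ler_pdivrMl// lambda2_le_cut.
Qed.

End CheegerInequality.

Theorem theorem4p1 (R : realType) (V E : finType) (p : R)
    (w : E -> R) (f g : E -> {set V} -> R)
    (V_gt1 : (1 < #|V|)%N)
    (p_ge1 : 1 <= p)
    (w_gt0 : forall e : E, 0 < w e)
    (f_ge0 : forall (e : E) (A : {set V}), 0 <= f e A)
    (g_ge0 : forall (e : E) (A : {set V}), 0 <= g e A)
    (f_set0 : forall e : E, f e finset.set0 = 0)
    (f_setT : forall e : E, f e ([set: V]%SET) = 0)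
    (g_set0 : forall e : E, g e finset.set0 = 0)
    (g_additive : forall (e : E) (A : {set V}),
        g e A = \sum_(i in A) g e ([set i]%SET))
    (g_gt0 : forall i : V, 0 < total_g g ([set i]%SET)) :
  (2 / const_c w f g) `^ (p - 1) * (cheeger w f g `^ p / p `^ p)
    <= lambda2 w f g p
  /\
  lambda2 w f g p <= 2 `^ (p - 1) * const_C f p * cheeger w f g.
Proof.
split; last exact: lambda2_le_cheeger.
by apply: lambda2_ge => // x; exact: rayleigh_ge.
Qed.
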